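(* Let $I$ be an ideal defining a point of $\widehat{\mathbb H}_\ell$, and let $m\ge\ell$. The state polytope $\mathcal P_{T,m}(I)$ is the convex hull of the set of characters $\chi_A$ as $A$ runs over all Plücker sets that are bases for the degree $m$ graded piece of some initial ideal of $I$.
   Context: Let $K$ be an algebraically closed field, $V$ an $(N+1)$-dimensional $K$-vector space with coordinates $x_0,\dots,x_N$, and $S=K[x_0,\dots,x_N]$ with graded pieces $S_d$. Let $T\subset \mathrm{SL}(V)$ be the maximal torus diagonal in these coordinates. A subscheme $X\subset\mathbb P(V)$ with ideal sheaf $I_X$ is $\ell$-nice if $V^\vee\to\Gamma(X,\mathcal O_X(1))$ is an isomorphism, $\mathcal O_X$ is $(\ell-1)$-regular and $I_X$ is $\ell$-regular. Fix an $\ell$-nice subscheme $X$ with homogeneous ideal $I(X)$, and set $\widehat Q(d)=\dim_K I(X)_d$ for $d\ge\ell$, $\widehat Q(d)=0$ for $d<\ell$. $\widehat{\mathbb H}_\ell$ is the multigraded Hilbert scheme parameterizing homogeneous ideals $I\subset S$ with $\dim_K I_d=\widehat Q(d)$ for all $d$; $[I]$ denotes the point of $I$. The point $g_m([I])\in\mathbb P(\bigwedge^{\widehat Q(m)}S_m)$ is the Plücker point of the subspace $I_m\subset S_m$. A Plücker set $A$ is a set of $\widehat Q(m)$ monomials of degree $m$; the Plücker coordinate $y_A$ of $g_m([I])$ is the minor, on the columns indexed by $A$, of the matrix whose rows are the coefficients of a basis of $I_m$ with respect to the monomial basis of $S_m$. The character $\chi_A\in\mathbb Z^{N+1}$ is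 the sum of the exponent vectors of the monomials in $A$. The state polytope $\mathcal P_{T,m}(I)$ is the convex hull in $\mathbb R^{N+1}$ of $\{\chi_A : y_A\ne 0\text{ at } g_m([I])\}$. An initial ideal of $I$ is the monomial ideal spanned by the leading monomials of non-zero elements of $I$ with respect to some multiplicative total order (monomial order) on the monomials of $S$; the coordinates $x_0,\dots,x_N$ are fixed throughout. *)

(* Defs.v *)
From mathcomp Require Import all_boot all_order all_algebra finmap.
From mathcomp Require Import boolp classical_sets reals.
From mathcomp Require Import mpoly.

Set Implicit Arguments.
Unset Strict Implicit.
Unset Printing Implicit Defensive.

Import Order.TTheory GRing.Theory Num.Theory.

Local Open Scope classical_set_scope.
Local Open Scope ring_scope.

Definition lspan (K : nzRingType) (V : lmodType K) (E : set V) : set V :=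
  [set v | exists s : seq (K * V),
     (forall cv, cv \in s -> E cv.2) /\ v = \sum_(cv <- s) cv.1 *: cv.2].

Definition convex_hull (R : realType) (V : lmodType R) (E : set V) : set V :=
  [set v | exists (k : nat) (w : 'I_k -> R) (x : 'I_k -> V),
     [/\ forall i, 0 <= w i, \sum_i w i = 1, forall i, E (x i)
       & v = \sum_i w i *: x i]].

Section Ideals.
Variables (K : fieldType) (n : nat).
Implicit Types (I J : set {mpoly K[n]}) (f g : {mpoly K[n]}).

Definition is_ideal I : Prop :=
  [/\ I 0, forall f g, I f -> I g -> I (f + g) & forall f g, I g -> I (f * g)].

Definition is_homogeneous I : Prop :=
  forall f, I f -> forall d, I (pihomog mdeg d f).

(* A closed subscheme of P^(n-1) is given by its saturated homogeneous ideal: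
   saturation is with respect to the ideal generated by the variables. *)
Definition closed_subscheme I : Prop :=
  [/\ is_ideal I, is_homogeneous I
    & forall f, (forall i, exists k, I ('X_i ^+ k * f)) -> I f].

(* Integer degrees are needed for twists by negative integers; only 0 is
   homogeneous of negative degree. *)
Definition homogz (d : int) f : Prop :=
  forall u, u \in msupp f -> (mdeg u)%:Z = d.

End Ideals.

(* Cech cohomology, for the covering of P^(n-1) by the sets U_i = {x_i != 0}, of
   the sheaf F(d), where F is associated with the graded module A / B, for
   homogeneous ideals B `<=` A: (I, 0) gives the ideal sheaf of I, and (S, I)
   gives the structure sheaf of the subscheme of I.
   We use all, possibly repeating, tuples s of indices. A section of F(d) over
   U_s = U_(s 0) :&: ... :&: U_(s p) is a fraction f / x_s ^ e, with x_s the
   product of the x_(s j) and f in A homogeneous of degree d + e (p + 1), in the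
   localization of A / B at x_s. Since there are finitely many s, a p-cochain
   can be given by a common exponent e and a family c of numerators. *)
Section Cech.
Variables (K : fieldType) (n : nat).
Implicit Types (A B : set {mpoly K[n]}) (d : int) (e : nat).

Definition cochain (p : nat) : Type := {ffun 'I_p -> 'I_n} -> {mpoly K[n]}.

Definition xs p (s : {ffun 'I_p -> 'I_n}) : {mpoly K[n]} := \prod_j 'X_(s j).

(* f / x_s ^ e and g / x_s ^ e' are equal in the localization of S / B at x_s *)
Definition frac_eq B p (s : {ffun 'I_p -> 'I_n}) f e g e' : Prop :=
  exists k, B (xs s ^+ k * (xs s ^+ e' * f - xs s ^+ e * g)).

Definition face p (k : 'I_p.+1) (s : {ffun 'I_p.+1 -> 'I_n}) :
  {ffun 'I_p -> 'I_n} := [ffun j => s (lift k j)].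

(* numerators, over the denominators x_s ^ e, of the differential of c / x ^ e *)
Definition cech_diff p e (c : cochain p) : cochain p.+1 :=
  fun s => \sum_(k < p.+1) (-1) ^+ k * ('X_(s k) ^+ e * c (face k s)).

Definition is_cochain A d p e (c : cochain p.+1) : Prop :=
  forall s, A (c s) /\ homogz (d + (e * p.+1)%:Z) (c s).

Definition is_cocycle A B d p e (c : cochain p.+1) : Prop :=
  is_cochain A d e c /\ forall s, frac_eq B s (cech_diff e c s) e 0 0.

(* H^(p+1) (P^(n-1), F(d)) = 0 *)
Definition HS_eq0 A B d p : Prop :=
  forall e (c : cochain p.+2), is_cocycle A B d e c ->
  exists e' (b : cochain p.+1),
    is_cochain A d e' b /\ forall s, frac_eq B s (cech_diff e' b s) e' (c s) e.

(* Castelnuovo-Mumford regularity: H^i (F(r - i)) = 0 for all i > 0 *)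
Definition regular A B (r : int) : Prop :=
  forall p : nat, HS_eq0 A B (r - p.+1%:Z) p.

(* S_1 -> H^0 (F(1)) is bijective, for F associated with S / B *)
Definition linear_forms_iso B : Prop :=
  (forall f, f \is 1.-homog ->
     (forall s : {ffun 'I_1 -> 'I_n}, frac_eq B s f 0 0 0) -> f = 0) /\
  (forall e (c : cochain 1), is_cocycle setT B 1 e c ->
     exists2 f, f \is 1.-homog & forall s, frac_eq B s (c s) e f 0).

Definition nice (l : nat) (IX : set {mpoly K[n]}) : Prop :=
  [/\ linear_forms_iso IX, regular setT IX (l%:Z - 1)
    & regular IX [set 0] l%:Z].

End Cech.

Section StatePolytope.
Variables (K : closedFieldType) (N : nat).
Local Notation n := N.+1.
Implicit Types (I : set {mpoly K[n]}) (A : {fset 'X_{1..n}}).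

(* The subspace I_d of S_d; see graded_pieceP. *)
Definition graded_piece I (d : nat) : {vspace dhomog n K d} :=
  xget 0%VS [set U | forall f : dhomog n K d, f \in U <-> I (val f)].

Lemma graded_pieceP I (d : nat) (f : dhomog n K d) :
  I 0 -> (forall a g h, I g -> I h -> I (a *: g + h)) ->
  f \in graded_piece I d <-> I (val f).
Proof.
move=> I0 IL; rewrite /graded_piece; case: xgetP => [U -> // | noU].
pose ok k := `[< exists2 U : {vspace dhomog n K d},
  (forall g, g \in U -> I (val g)) & \dim U = k >].
have ex_ok : exists k, ok k.
  exists 0; apply/asboolP; exists 0%VS; last by rewrite dimv0.
  by move=> g; rewrite memv0 => /eqP ->.
have ub_ok k : ok k -> (k <= \dim {:dhomog n K d})%N.
  by move=> /asboolP[U _ <-]; apply/dimvS/subvf.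
case: (ex_maxnP ex_ok ub_ok) => k /asboolP[U UI dU] maxk.
case: (noU U) => g; split=> [|Ig]; first exact: UI.
have: ok (\dim (<[g]> + U)).
  apply/asboolP; exists (<[g]> + U)%VS => // h /memv_addP[_ /vlineP[a ->]].
  by move=> [u /UI Iu ->]; apply: IL.
move=> /maxk; rewrite -dU => le_dim.
have /eqP -> : U == (<[g]> + U)%VS by rewrite eqEdim addvSr.
by apply: (subvP (addvSl _ _)); apply: memv_line.
Qed.

Definition Qhat (l : nat) (IX : set {mpoly K[n]}) (d : nat) : nat :=
  if (l <= d)%N then \dim (graded_piece IX d) else 0%N.

(* K-points of the multigraded Hilbert scheme with Hilbert function Q *)
Definition hilbert_point (Q : nat -> nat) I : Prop :=
  [/\ is_ideal I, is_homogeneous I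
    & forall d, \dim (graded_piece I d) = Q d].

Definition plucker_set (q m : nat) A : Prop :=
  #|` A| = q /\ forall u, u \in A -> mdeg u = m.

(* The minor on the columns A of the matrix of the coefficients of b; an
   enumeration of A is chosen, which only affects the sign. *)
Definition plucker_coord m (b : seq (dhomog n K m)) A : K :=
  \det (\matrix_(i < size b, j < size b) (val b`_i)@_(nth 0%MM A j)).

Definition chi A : 'rV[int]_n := \row_i \sum_(u <- A) (u i)%:Z.

Definition chiR (R : realType) A : 'rV[R]_n := map_mx intr (chi A).

Definition state_polytope (R : realType) (q m : nat) I : set 'rV[R]_n :=
  convex_hull (chiR R @` [set A | plucker_set q m A /\
    plucker_coord (vbasis (graded_piece I m)) A != 0]).

Definition monomial_order (le : rel 'X_{1..n}) : Prop :=
  [/\ antisymmetric le, transitive le, total le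
    & forall u v w, le u v -> le (u + w)%MM (v + w)%MM].

Definition is_lead (le : rel 'X_{1..n}) (f : {mpoly K[n]}) u : Prop :=
  u \in msupp f /\ forall v, v \in msupp f -> le v u.

Definition initial_ideal (le : rel 'X_{1..n}) I : set {mpoly K[n]} :=
  lspan [set 'X_[u] | u in
    [set u | exists f, [/\ I f, f != 0 & is_lead le f u]]].

Definition monomials_basis m A (J : set {mpoly K[n]}) : Prop :=
  basis_of (graded_piece J m) [seq indhomog m 'X_[u] | u <- A].

End StatePolytope.

Arguments state_polytope {K N} R q m I.
Arguments chiR {N} R A.

(* Main.v *)
Require Import Defs.
From mathcomp Require Import all_boot all_order all_algebra finmap.
From mathcomp Require Import boolp classical_sets reals.
From mathcomp Require Import mpoly.
From mathcomp Require Import perm lra.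

Set Implicit Arguments.
Unset Strict Implicit.
Unset Printing Implicit Defensive.

Import Order.TTheory GRing.Theory Num.Theory.

Local Open Scope classical_set_scope.
Local Open Scope ring_scope.

(** The two inclusions rest on one characterization of the nonvanishing of a
    Plucker coordinate ([plucker_coord_neq0]): if [A] has as many elements as
    the dimension of [U = I_m], then [y_A] is nonzero iff no nonzero element of
    [U] has all its coefficients on [A] equal to 0. This does not depend on the
    basis of [U] used to compute the minor.

    Fix a monomial order. Since [I] is homogeneous, the monomials of degree [m]
    of the initial ideal are the leading monomials [B] of the elements of [U]
    ([monomials_basisP]), and choosing [F u] in [U] with leading monomial [u],
    for [u] in [B], gives a basis of [U] ([lead_basis]). A nonzero element of
    [U] has a nonzero coefficient on its leading monomial, which is in [B], so
    that [y_B] is nonzero. This is one inclusion.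

    For the other one, suppose that a point [v] of the state polytope is not in
    the convex hull of the characters [chi_B] of the initial ideals. As these
    are finitely many, a linear form [w] separates them strictly from [v]
    ([convex_hull_separation], deduced from Farkas' lemma). Comparing monomials
    by their [w]-weights, with ties broken by a fixed monomial order, is a
    monomial order; let [B] be its set of leading monomials of [U]. If [y_A] is
    nonzero, some term of the expansion of the minor on [A] of the basis [F] is
    nonzero; it gives a bijection from [B] to [A] that sends each [u] to a
    monomial of [F u], hence to one of weight at most that of [u]. Therefore
    [w . chi_A <= w . chi_B] ([plucker_weight_le]). So the value of [w] at [v],
    a convex combination of such [chi_A], is at most [w . chi_B], against the
    choice of [w]. *)

(** * Separation of a point from a finitely generated convex hull *)

(** Farkas' lemma for scalar forms on a vector space of any dimension, proved
    by induction on the number [k] of forms, after D. Bartl. *)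
Lemma farkas (R : realFieldType) (V : lmodType R) (k : nat)
    (a : 'I_k -> V -> R) (g : V -> R) :
  (forall i, scalar (a i)) -> scalar g ->
  (forall x, (forall i, a i x <= 0) -> g x <= 0) ->
  exists2 u : 'I_k -> R, (forall i, 0 <= u i)
    & forall x, g x = \sum_i u i * a i x.
Proof.
elim: k a g => [|k IHk] a g a_lin g_lin g_le0.
  exists (fun=> 0) => // x; rewrite big_ord0; apply/le_anti.
  rewrite g_le0 => [|[]//]; rewrite -oppr_le0 /=.
  have g0 : g 0 = 0 by have := g_lin (-1) 0 0; rewrite scaler0 addr0; lra.
  have -> : - g x = g (- x).
    by have := g_lin (-1) x 0; rewrite addr0 scaleN1r g0 addr0 mulN1r.
  by rewrite g_le0 // => -[].
pose a0 := a ord0; pose a' i := a (lift ord0 i).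
(* Either the form [a0] is not needed, or some [x0] witnesses that it is; then
   all forms are restricted to the kernel of [a0], along [x0]. *)
have [a'_g|/existsNP[x0 /not_implyP[a'x0 /negP]]] :=
    pselect (forall x, (forall i, a' i x <= 0) -> g x <= 0).
  have [u u_ge0 gE] := IHk a' g (fun i => a_lin _) g_lin a'_g.
  exists (fun i => if unlift ord0 i is Some j then u j else 0) => [i|x].
    by case: unlift.
  rewrite big_ord_recl unlift_none mul0r add0r gE.
  by apply: eq_bigr => i _; rewrite liftK.
rewrite -ltNge => gx0.
have a0x0 : 0 < a0 x0.
  rewrite ltNge; apply/negP => a0x0; move: gx0; apply/negP; rewrite -leNgt.
  by apply: g_le0 => i; case: (unliftP ord0 i) => [j ->|->]; rewrite ?a'x0.
pose proj (f : V -> R) x := f x - f x0 * (a0 x / a0 x0).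
have projE f x : scalar f -> proj f x = f (- (a0 x / a0 x0) *: x0 + x).
  by move=> ->; rewrite /proj; lra.
have proj_lin f : scalar f -> scalar (proj f).
  by move=> f_lin c x y; rewrite /proj f_lin /a0 a_lin; lra.
have [|||u u_ge0 gE] := IHk (fun i => proj (a' i)) (proj g).
- by move=> i; apply/proj_lin/a_lin.
- exact: proj_lin.
- move=> x x_le0; rewrite projE //; apply: g_le0 => i.
  case: (unliftP ord0 i) => [j ->|->].
    by rewrite -projE; [exact: x_le0 | exact: a_lin].
  by rewrite a_lin -/a0 mulNr divfK ?gt_eqF // addNr.
(* [u0] is the coefficient of [a0] obtained by expanding [proj]. *)
pose u0 := (g x0 - \sum_i u i * a' i x0) / a0 x0.
exists (fun i => if unlift ord0 i is Some j then u j else u0) => [i|x].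
  case: unlift => // ; apply: divr_ge0; last exact: ltW.
  rewrite subr_ge0; apply: le_trans (ltW gx0); apply: sumr_le0 => j _.
  exact: mulr_ge0_le0.
rewrite big_ord_recl unlift_none (eq_bigr (fun i => u i * a' i x)); last first.
  by move=> i _; rewrite liftK.
have := gE x; rewrite /proj (eq_bigr (fun i =>
  u i * a' i x - u i * a' i x0 * (a0 x / a0 x0))); last by move=> i _; lra.
rewrite sumrB -mulr_suml => /eqP; rewrite subr_eq => /eqP ->.
by rewrite /u0 -/a0; lra.
Qed.

(** A point outside the convex hull of [E] is strictly separated by a linear
    form from any finite family of points of [E]. *)
Lemma convex_hull_separation (R : realType) (d k : nat) (E : set 'rV[R]_d)
    (x : 'I_k -> 'rV[R]_d) (b : 'rV[R]_d) :
  (forall i, E (x i)) -> ~ convex_hull E b ->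
  exists (w : 'cV[R]_d) (t : R),
    (forall i, (x i *m w) 0 0 <= t) /\ t < (b *m w) 0 0.
Proof.
move=> Ex; apply: contra_notP => no_w.
(* Affine forms [y . w - t] on the points are linear in [(w, t)]. *)
pose ev (y : 'rV[R]_d) (p : 'cV[R]_d * R^o) : R := (y *m p.1) 0 0 - p.2.
have ev_lin y : scalar (ev y).
  move=> c [w t] [w' t']; rewrite /ev /= mulmxDr -scalemxAr !mxE.
  by rewrite /GRing.scale /=; lra.
have [[w t] /= ev_le0|u u_ge0 evE] := farkas (fun i => ev_lin (x i)) (ev_lin b).
  rewrite leNgt; apply/negP => ev_gt0; apply: no_w; exists w, t; split.
    by move=> i; rewrite -subr_le0; apply: ev_le0.
  by rewrite -subr_gt0.
(* The identity of forms is evaluated at [(0, -1)] for the sum of the weights,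
   and at the unit vectors for the coordinates of [b]. *)
exists k, u, x; split => //.
  have := evE (0, -1); rewrite /ev /= mulmx0 mxE sub0r [LHS]opprK => ->.
  by apply: eq_bigr => i _; rewrite mulmx0 mxE sub0r [X in _ * X]opprK mulr1.
apply/rowP => j; have := evE (delta_mx j 0, 0).
rewrite /ev /= -colE mxE subr0 summxE => ->.
by apply: eq_bigr => i _; rewrite -colE !mxE subr0.
Qed.

(** * Plucker coordinates and leading monomials of a subspace of forms *)

Lemma exists_max (T : eqType) (le : rel T) (s : seq T) :
  transitive le -> total le -> s != [::] ->
  exists2 u, u \in s & forall v, v \in s -> le v u.
Proof.
move=> le_tr le_tot.
have le_refl u : le u u by have := le_tot u u; rewrite orbb.
elim: s => // u s IHs _; have [->|/IHs[v vs v_max]] := eqVneq s [::].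
  by exists u => [|w]; rewrite !inE // => /eqP->.
have [uv|vu] := orP (le_tot u v).
  exists v => [|w]; rewrite inE ?vs ?orbT // => /orP[/eqP->//|].
  exact: v_max.
exists u => [|w]; rewrite inE ?eqxx // => /orP[/eqP->//|/v_max wv].
exact: le_tr wv vu.
Qed.

Section LeadingMonomials.
Variables (K : closedFieldType) (N m : nat).
Local Notation n := N.+1.
Implicit Types (U : {vspace dhomog n K m}) (b : seq (dhomog n K m)).
Implicit Types (A B : {fset 'X_{1..n}}) (f : dhomog n K m).

Lemma coef_sum k (c : 'I_k -> K) (F : 'I_k -> dhomog n K m) u :
  (val (\sum_i c i *: F i))@_u = \sum_i c i * (val (F i))@_u.
Proof.
rewrite linear_sum raddf_sum; apply: eq_bigr => i _.
by rewrite /= mcoeffZ.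
Qed.

(** The rows of the matrix of coefficients of a free family [b] on [k] monomials
    are independent iff no nonzero element of the span of [b] vanishes on all of
    these monomials. *)
Lemma coefmx_row_free b k (s : nat -> 'X_{1..n}) :
  free b ->
  row_free (\matrix_(i < size b, j < k) (val b`_i)@_(s j)) <->
  (forall f, f \in <<b>>%VS -> (forall j, (j < k)%N -> (val f)@_(s j) = 0) ->
     f = 0).
Proof.
move=> b_free; split=> [M_free f fb f0|f_eq0].
  have := coord_span (X := in_tuple b) fb => fE.
  pose c := \row_i coord (in_tuple b) i f.
  have c0 : c = 0.
    apply: (row_free_inj M_free); rewrite mul0mx; apply/rowP => j.
    rewrite !mxE -[RHS](f0 j (ltn_ord j)) [in RHS]fE coef_sum.
    by apply: eq_bigr => i _; rewrite !mxE.
  rewrite fE big1 // => i _; move/rowP/(_ i): c0; rewrite !mxE => ->.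
  by rewrite scale0r.
rewrite -kermx_eq0; apply/eqP/row_matrixP => r; rewrite row0.
set M := (X in kermx X); pose c := row r (kermx M).
have cM : c *m M = 0 by rewrite -row_mul mulmx_ker row0.
have: \sum_i c 0 i *: (in_tuple b)`_i = 0.
  apply: f_eq0 => [|j jk].
    by apply: memv_suml => i _; apply/memvZ/memv_span/mem_nth.
  rewrite coef_sum; transitivity ((c *m M) 0 (Ordinal jk)).
    by rewrite [RHS]mxE; apply: eq_bigr => i _; rewrite [M _ _]mxE.
  by rewrite cM mxE.
move=> /(elimT (freeP (X := in_tuple b)) b_free) c0.
by apply/rowP => i; rewrite -/c c0 mxE.
Qed.

Lemma plucker_coord_neq0 U b A : basis_of U b -> #|` A| = size b ->
  plucker_coord b A != 0 <->
  (forall f, f \in U -> (forall u, u \in A -> (val f)@_u = 0) -> f = 0).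
Proof.
move=> bU sA; rewrite /plucker_coord -unitfE -unitmxE -row_free_unit.
have := coefmx_row_free (size b) (nth 0%MM A) (basis_free bU).
rewrite (span_basis bU) => ->.
split=> f_eq0 f fU f0; apply: f_eq0 => //.
  by move=> j jb; apply: f0; apply: mem_nth; rewrite [size _]sA.
by move=> u uA; rewrite -(nth_index 0%MM uA) f0 // -sA index_mem.
Qed.

Lemma plucker_coord_perm b A : plucker_coord b A != 0 ->
  exists s : {perm 'I_(size b)},
    forall i, nth 0%MM A (s i) \in msupp (val b`_i).
Proof.
move=> yA; apply: contrapT => no_s; case/negP: yA; apply/eqP.
rewrite /plucker_coord /determinant big1 // => s _.
have /existsNP[i /negP si] : ~ forall i, nth 0%MM A (s i) \in msupp (val b`_i).
  by move=> ?; apply: no_s; exists s.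
by rewrite (bigD1 i) //= mxE (memN_msupp_eq0 si) mul0r mulr0.
Qed.

Variable le : rel 'X_{1..n}.
Hypothesis le_mon : monomial_order le.

Lemma exists_lead (f : {mpoly K[n]}) : f != 0 -> exists u, is_lead le f u.
Proof.
case: le_mon => _ le_tr le_tot _; rewrite -msupp_eq0 => f_neq0.
by have [u uf u_max] := exists_max le_tr le_tot f_neq0; exists u.
Qed.

Lemma mdeg_lead f u : is_lead le (val f) u -> mdeg u = m.
Proof. by case=> uf _; apply: (dhomog_mf (dhomog_is_dhomog f)). Qed.

Lemma lead_free (s : seq 'X_{1..n}) (F : 'X_{1..n} -> dhomog n K m) :
  uniq s -> (forall u, u \in s -> is_lead le (val (F u)) u) ->
  free [seq F u | u <- s].
Proof.
move=> s_uniq F_lead; apply/(freeP (X := map_tuple F (in_tuple s))) => c c0 i0.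
apply/eqP/negPn/negP => ci0.
(* The coefficient of a relation at the largest leading monomial among its
   nonzero terms comes from one term only. *)
pose S := [seq tnth (in_tuple s) i | i <- enum 'I_(size s) & c i != 0].
have [le_anti le_tr le_tot _] := le_mon.
have [|u /mapP[i]] := exists_max (s := S) le_tr le_tot.
  apply: contraTneq (_ : tnth (in_tuple s) i0 \in S) => [->//|].
  by apply: map_f; rewrite mem_filter ci0 mem_enum.
rewrite mem_filter => /andP[ci _] uE u_max.
have us : u \in s by rewrite uE mem_tnth.
have [u_supp _] := F_lead u us.
have: (val (\sum_(i < size s) c i *: (map_tuple F (in_tuple s))`_i))@_u = 0.
  by rewrite c0 mcoeff0.
rewrite coef_sum (bigD1 i) //= big1 => [|j ji].
  rewrite addr0 => /eqP; rewrite mulf_eq0 (negPf ci) (nth_map 0%MM) //=.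
  by rewrite -(tnth_nth _ (in_tuple s)) -uE mcoeff_eq0 u_supp.
have [->|cj] := eqVneq (c j) 0; first by rewrite mul0r.
rewrite (nth_map 0%MM) // -(tnth_nth _ (in_tuple s)).
set v := tnth _ j; have vs : v \in s by rewrite mem_tnth.
have [_ v_max] := F_lead v vs.
rewrite memN_msupp_eq0 ?mulr0 //; apply/negP => /v_max uv.
have vu : le v u by apply/u_max/map_f; rewrite mem_filter cj mem_enum.
have u_eq_v : u = v by apply: le_anti; rewrite uv vu.
case/negP: ji; rewrite -val_eqE -(nth_uniq 0%MM (ltn_ord j) (ltn_ord i) s_uniq).
by rewrite -!(tnth_nth _ (in_tuple s)) -uE -/v u_eq_v.
Qed.

(** The leading monomials of a subspace of forms of degree [m] form a finite
    set. *)
Lemma exists_lead_fset U : exists B : {fset 'X_{1..n}},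
  forall u, u \in B <-> exists2 f, f \in U & is_lead le (val f) u.
Proof.
pose F : {fset 'X_{1..n}} := [fset bmnm u | u in {: 'X_{1..n < m.+1}}]%fset.
pose P u := `[< exists2 f, f \in U & is_lead le (val f) u >].
exists [fset u in F | P u]%fset => u; rewrite !inE /=; split.
  by case/andP => _ /asboolP.
move=> Pu; apply/andP; split; last exact/asboolP.
have um : (mdeg u < m.+1)%N by case: Pu => f _ /mdeg_lead ->.
by apply/imfsetP; exists (BMultinom um).
Qed.

(** A family with one element for each leading monomial of [U] is a basis: it is
    free, and there are at least [\dim U] leading monomials because an element
    of [U] that vanishes on all of them is 0. *)
Lemma lead_basis U B :
  (forall u, u \in B <-> exists2 f, f \in U & is_lead le (val f) u) ->
  exists2 F : 'X_{1..n} -> dhomog n K m,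
    (forall u, u \in B -> is_lead le (val (F u)) u)
    & basis_of U [seq F u | u <- B].
Proof.
move=> BP; pose F u := xget (0 : dhomog n K m)
  [set f | f \in U /\ is_lead le (val f) u].
have FP u : u \in B -> F u \in U /\ is_lead le (val (F u)) u.
  move=> /BP[f fU fu]; rewrite /F.
  by case: xgetP => [g _ //|/(_ f) []].
exists F => [u /FP[]//|].
have F_free : free [seq F u | u <- B].
  by apply: lead_free => [|u /FP[]//]; apply: fset_uniq.
rewrite basisEfree F_free size_map /=; apply/andP; split.
  by apply/span_subvP => _ /mapP[u /FP[FU _] ->].
suff f_eq0 f : f \in U ->
    (forall j, (j < size B)%N -> (val f)@_(nth 0%MM B j) = 0) -> f = 0.
  rewrite -(size_tuple (vbasis U)).
  have := coefmx_row_free (size B) (nth 0%MM B) (basis_free (vbasisP U)).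
  rewrite (span_basis (vbasisP U)) => -[_ /(_ f_eq0)/eqP rankM].
  by rewrite -[leqLHS]rankM rank_leq_col.
move=> fU f0; apply: contrapT => /eqP f_neq0.
have [u uf] : exists u, is_lead le (val f) u by apply: exists_lead.
have uB : u \in B by apply/BP; exists f.
case: uf; rewrite mcoeff_msupp -(nth_index 0%MM uB) f0 ?eqxx //.
by rewrite index_mem.
Qed.

(** The set of leading monomials has the largest total weight among the sets
    with a nonzero Plucker coordinate, for any weight that the monomial order
    respects. *)
Lemma plucker_weight_le (R : numDomainType) (wt : 'X_{1..n} -> R) U b A B :
  (forall u v, le u v -> wt u <= wt v) ->
  (forall u, u \in B <-> exists2 f, f \in U & is_lead le (val f) u) ->
  basis_of U b -> #|` A| = \dim U -> plucker_coord b A != 0 ->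
  \sum_(u <- A) wt u <= \sum_(u <- B) wt u.
Proof.
move=> wt_mono BP bU sA.
have [F F_lead FU] := lead_basis BP.
have sF : #|` A| = size [seq F u | u <- B].
  by rewrite sA (vector.size_basis (X := in_tuple _) FU).
rewrite (plucker_coord_neq0 bU); last first.
  by rewrite sA (vector.size_basis (X := in_tuple _) bU).
rewrite -(plucker_coord_neq0 FU) // => /plucker_coord_perm[s sP].
have sB : size [seq F u | u <- B] = size B by rewrite size_map.
rewrite (big_nth 0%MM) [leRHS](big_nth 0%MM) -[size A]/(#|` A|) sF -sB.
rewrite !big_mkord (reindex_inj (@perm_inj _ s)); apply: ler_sum => i _.
have iB : (i < size B)%N by rewrite -sB.
apply: wt_mono; have [_] := F_lead _ (mem_nth 0%MM iB); apply.
by have := sP i; rewrite (nth_map 0%MM).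
Qed.

End LeadingMonomials.

(** * Graded pieces of initial ideals *)

Lemma ideal_linear (K : fieldType) (n : nat) (I : set {mpoly K[n]})
    (a : K) g h :
  is_ideal I -> I g -> I h -> I (a *: g + h).
Proof.
by case=> _ ID IM Ig Ih; apply: ID => //; rewrite -mul_mpolyC; apply: IM.
Qed.

Lemma lspan_monomials (K : nzRingType) (n : nat) (E : set 'X_{1..n})
    (f : {mpoly K[n]}) :
  lspan [set ('X_[u] : {mpoly K[n]}) | u in E] f <->
  (forall u, u \in msupp f -> E u).
Proof.
split=> [[s [sE ->]] u|fE].
  rewrite mcoeff_msupp raddf_sum /= => u_supp; apply: contrapT => nEu.
  case/eqP: u_supp; rewrite big_seq big1 // => -[c v] /sE[w Ew /= <-].
  rewrite mcoeffZ mcoeffX; case: eqP => [wu|_]; last by rewrite mulr0.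
  by case: nEu; rewrite -wu.
exists [seq (f@_u, 'X_[u]) | u <- msupp f]; split; last first.
  by rewrite big_map /= -mpolyE.
by move=> _ /mapP[u uf ->] /=; exists u => //; apply: fE.
Qed.

Lemma mcoeff_pihomog (K : nzRingType) (n d : nat) (f : {mpoly K[n]})
    (u : 'X_{1..n}) :
  (pihomog mdeg d f)@_u = if mdeg u == d then f@_u else 0.
Proof.
rewrite pihomogE raddf_sum /= [in RHS](mpolyE f) [in RHS]raddf_sum /=.
rewrite big_mkcond /=; case: eqP => ud; last first.
  rewrite big1 // => v _; case: eqP => // vd.
  rewrite mcoeffZ mcoeffX; case: eqP => [vu|_]; last by rewrite mulr0.
  by case: ud; rewrite -vu.
apply: eq_bigr => v _; rewrite mcoeffZ mcoeffX.
by have [->|uv] := eqVneq v u; rewrite ?ud ?eqxx ?mulr0 ?if_same.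
Qed.

Section InitialIdeals.
Variables (K : closedFieldType) (N : nat).
Local Notation n := N.+1.
Implicit Types (I : set {mpoly K[n]}) (le : rel 'X_{1..n}).

Lemma mem_graded_ideal I d (f : dhomog n K d) : is_ideal I ->
  f \in graded_piece I d <-> I (val f).
Proof.
move=> I_ideal; apply: graded_pieceP => [|a g h]; first by case: I_ideal.
exact: ideal_linear.
Qed.

Lemma initial_idealP le I (f : {mpoly K[n]}) :
  initial_ideal le I f <->
  (forall u, u \in msupp f -> exists2 g, I g & is_lead le g u).
Proof.
rewrite /initial_ideal lspan_monomials; split=> fI u /fI.
  by case=> g [Ig _ gu]; exists g.
case=> g Ig gu; exists g; split => //; case: gu => ug _.
by apply: contraTneq ug => ->; rewrite msupp0.
Qed.

Lemma mem_graded_initial le I d (f : dhomog n K d) :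
  f \in graded_piece (initial_ideal le I) d <->
  (forall u, u \in msupp (val f) -> exists2 g, I g & is_lead le g u).
Proof.
rewrite -initial_idealP; apply: graded_pieceP => [|a g h].
  by apply/initial_idealP => u; rewrite msupp0.
move=> /initial_idealP gI /initial_idealP hI; apply/initial_idealP => u.
move=> /msuppD_le; rewrite mem_cat => /orP[/msuppZ_le|]; [exact: gI|exact: hI].
Qed.

(** In a homogeneous ideal, passing to the homogeneous component that contains
    the leading monomial keeps this leading monomial. *)
Lemma homogeneous_lead le I d u : is_ideal I -> is_homogeneous I ->
  (exists2 f, f \in graded_piece I d & is_lead le (val f) u) <->
  mdeg u = d /\ exists2 g, I g & is_lead le g u.
Proof.
move=> I_ideal I_homog; split=> [[f fI fu]|[<- [g Ig [ug u_max]]]].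
  split; first exact: mdeg_lead fu.
  by exists (val f) => //; apply/(mem_graded_ideal _ I_ideal).
exists (DHomog (pihomogP mdeg (mdeg u) g)).
  by apply/(mem_graded_ideal _ I_ideal); apply: I_homog.
split=> [|v] /=; rewrite mcoeff_msupp mcoeff_pihomog.
  by rewrite eqxx -mcoeff_msupp.
case: (mdeg v =P mdeg u) => _; last by rewrite eqxx.
by rewrite -mcoeff_msupp; apply: u_max.
Qed.

(** A set of monomials of degree [d] is a basis of the degree [d] piece of the
    initial ideal iff it is the set of leading monomials of [I_d]. *)
Lemma monomials_basisP le I d (A : {fset 'X_{1..n}}) :
  monomial_order le -> is_ideal I -> is_homogeneous I ->
  (forall u, u \in A -> mdeg u = d) ->
  monomials_basis d A (initial_ideal le I) <->
  (forall u, u \in A <->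
     exists2 f, f \in graded_piece I d & is_lead le (val f) u).
Proof.
move=> le_mon I_ideal I_homog Ad; pose X u : dhomog n K d := indhomog d 'X_[u].
have XE u : mdeg u = d -> val (X u) = 'X_[u].
  move=> ud; apply: insubdK.
  change (is_true (('X_[u] : {mpoly K[n]}) \is d.-homog)).
  by rewrite dhomogX; apply/eqP.
have XP u : mdeg u = d -> X u \in graded_piece (initial_ideal le I) d <->
    exists2 f, f \in graded_piece I d & is_lead le (val f) u.
  move=> ud; rewrite homogeneous_lead // mem_graded_initial (XE u ud) msuppX.
  split=> [H|[_ H] v]; last by rewrite inE => /eqP ->.
  by split=> //; apply: H; rewrite inE.
split=> [A_basis u|AP].
  split=> [uA|uP].
    by apply/XP; rewrite ?Ad //; apply/(basis_mem A_basis)/map_f.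
  have ud : mdeg u = d by move: uP; rewrite homogeneous_lead // => -[].
  move/XP: (uP) => /(_ ud); rewrite -(span_basis A_basis) => Xu.
  apply: contraTT isT => uA.
  have := coord_span (X := in_tuple _) Xu => /(congr1 (fun f => (val f)@_u)).
  rewrite XE // mcoeffX eqxx coef_sum big1 => [/eqP|i _].
    by rewrite oner_eq0.
  have iA : (i < size A)%N by rewrite -(size_map X) ltn_ord.
  rewrite (nth_map 0%MM) // XE ?Ad ?mem_nth // mcoeffX.
  case: eqP; rewrite ?mulr0 // => Au.
  by move: uA; rewrite -Au mem_nth.
rewrite /monomials_basis; apply/andP; split; last first.
  apply: (lead_free le_mon) (fset_uniq A) _ => u uA.
  rewrite XE ?Ad //; split=> [|v]; rewrite msuppX inE // => /eqP->.
  by case: le_mon => _ _ le_tot _; have := le_tot u u; rewrite orbb.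
rewrite eqEsubv; apply/andP; split.
  apply/span_subvP => _ /mapP[u uA ->]; apply/XP; first exact: Ad.
  exact/AP.
apply/subvP => f; rewrite mem_graded_initial => fJ.
have fA u : u \in msupp (val f) -> u \in A.
  move=> uf; apply/AP; rewrite homogeneous_lead //; split; last exact: fJ.
  exact: (dhomog_mf (dhomog_is_dhomog f)).
have -> : f = \sum_(u <- msupp (val f)) (val f)@_u *: X u.
  apply: val_inj; rewrite /= raddf_sum /= {1}[mpoly_of_dhomog f]mpolyE !big_seq.
  by apply: eq_bigr => u /fA/Ad/XE uE; rewrite -[in LHS]uE.
rewrite big_seq; apply: memv_suml => u /fA uA.
by apply/memvZ/memv_span/map_f.
Qed.

End InitialIdeals.

(** * The monomial order of a real weight *)

Section WeightOrder.
Variables (R : realDomainType) (N : nat)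
  (w : 'cV[R]_N.+1).
Implicit Types u v : 'X_{1..N.+1}.

(** The value at the exponent vector of [u] of the linear form with
    coefficients [w]. *)
Definition weight u : R := \sum_j (u j)%:R * w j 0.

(** Monomials are compared by weight, and by the graded lexicographic order of
    the polynomial library when their weights are equal. The weights may be
    negative, so 1 need not be the least monomial. *)
Definition weight_order : rel 'X_{1..N.+1} :=
  fun u v => (weight u < weight v) || (weight u == weight v) && (u <= v)%O.

Lemma weightD u v : weight (u + v)%MM = weight u + weight v.
Proof.
rewrite /weight -big_split /=; apply: eq_bigr => j _.
by rewrite mnmDE natrD mulrDl.
Qed.

Lemma weight_order_le u v : weight_order u v -> weight u <= weight v.
Proof. by case/orP => [/ltW//|/andP[/eqP-> _]]. Qed.

Lemma weight_order_monomial : monomial_order weight_order.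
Proof.
rewrite /weight_order; split=> [u v|v u x|u v|u v x].
- by case: ltgtP => //= _; apply: le_anti.
- case: ltgtP => //= [uv _|uv uv']; case: ltgtP => //= vx.
  + by rewrite (lt_trans uv vx).
  + by rewrite -vx uv.
  + by rewrite uv vx.
  + by rewrite uv vx eqxx ltxx /=; apply: le_trans.
- by case: ltgtP => //= _; apply: le_total.
- by rewrite !weightD ltrD2r (inj_eq (addIr _)) lemc_add2l.
Qed.

End WeightOrder.

Lemma chiR_mul (R : realType) (N : nat) (A : {fset 'X_{1..N.+1}})
    (w : 'cV[R]_N.+1) :
  (chiR R A *m w) 0 0 = \sum_(u <- A) weight w u.
Proof.
rewrite mxE exchange_big /=; apply: eq_bigr => j _.
by rewrite !mxE raddf_sum mulr_suml.
Qed.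

(** * State polytope and initial ideals *)

Theorem corollary3p14 (R : realType) (K : closedFieldType) (N l : nat)
    (IX : set {mpoly K[N.+1]}) (X_subscheme : closed_subscheme IX)
    (X_nice : nice l IX)
    (I : set {mpoly K[N.+1]}) (hI : hilbert_point (Qhat l IX) I)
    (m : nat) (lm : (l <= m)%N) :
  state_polytope R (Qhat l IX m) m I =
  convex_hull (chiR R @` [set A : {fset 'X_{1..N.+1}} |
    plucker_set (Qhat l IX m) m A /\
    exists2 le : rel 'X_{1..N.+1}, monomial_order le
      & monomials_basis m A (initial_ideal le I)]).
Proof.
have [I_ideal I_homog /(_ m) dimI] := hI.
set Q := Qhat l IX m in dimI *; set U := graded_piece I m in dimI.
have sbU : size (vbasis U) = Q by rewrite size_tuple.
apply/seteqP; split=> [v|v [k [c [x [c_ge0 c_sum xE ->]]]]]; last first.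
  exists k, c, x; split=> // i.
  have [A [[sA Ad] [le le_mon A_basis]] <-] := xE i.
  exists A => //; split=> //.
  apply/(plucker_coord_neq0 (vbasisP U)); first by rewrite sbU.
  move=> f fU f0; apply: contrapT => /eqP f_neq0.
  have [u fu] : exists u, is_lead le (val f) u by apply: exists_lead.
  have uA : u \in A.
    apply/(iffLR (monomials_basisP le_mon I_ideal I_homog Ad) A_basis).
    by exists f.
  by case: fu; rewrite mcoeff_msupp f0 ?eqxx.
case=> k [c [x [c_ge0 c_sum xE ->]]].
set C := [set A | _]; apply: contrapT => not_hull.
(* The sets [A] in [C] are subsets of the finite set of monomials of degree at
   most [m], hence can be enumerated. *)
pose mon : {fset 'X_{1..N.+1}} :=
  [fset bmnm u | u in {: 'X_{1..N.+1 < m.+1}}]%fset.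
have mem_mon u : (mdeg u < m.+1)%N -> u \in mon.
  by move=> um; apply/imfsetP; exists (BMultinom um).
pose Cs := [seq A <- fpowerset mon | `[< C A >]].
have CsP A : C A <-> A \in Cs.
  rewrite mem_filter fpowersetE; split=> [CA|/andP[/asboolP//]].
  apply/andP; split; first exact/asboolP.
  by apply/fsubsetP => u uA; apply: mem_mon; case: CA => -[_ ->].
have [|w [t [w_le w_gt]]] := @convex_hull_separation R N.+1 (size Cs)
    (chiR R @` C) (fun i => chiR R (tnth (in_tuple Cs) i)) _ _ not_hull.
  by move=> i; exists (tnth (in_tuple Cs) i) => //; apply/CsP/mem_tnth.
have le_mon := weight_order_monomial w.
have [B BP] := exists_lead_fset (weight_order w) U.
have [F _ FU] := lead_basis le_mon BP.
have BC : C B.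
  have Bd u : u \in B -> mdeg u = m by case/BP => f _ /mdeg_lead.
  split; first split=> //.
    by rewrite -dimI (vector.size_basis (X := in_tuple _) FU) size_map.
  by exists (weight_order w) => //; apply/monomials_basisP.
have B_le : (chiR R B *m w) 0 0 <= t.
  move/CsP: BC => /(tnthP (in_tuple Cs))[i ->]; exact: w_le.
move: w_gt; apply/negP; rewrite -leNgt; apply: le_trans B_le.
rewrite mulmx_suml summxE -[leRHS]mul1r -c_sum mulr_suml.
apply: ler_sum => i _; have [A [[sA Ad] yA] <-] := xE i.
rewrite -scalemxAl mxE ler_wpM2l // !chiR_mul.
apply: (plucker_weight_le le_mon _ BP (vbasisP U)) yA; last by rewrite dimI.
exact: weight_order_le.
Qed.
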